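(* For all integers $N \ge 1$ and $0 \le r \le N$, $$\max_{d \in \mathcal{D}_{N,r}} C_{\min}(d) = C\big(d^{\mathrm{chr}}_{N,r}\big).$$ Moreover, the maximum is attained uniquely, up to rotation, at $d = d^{\mathrm{chr}}_{N,r}$; that is, a word $d \in \mathcal{D}_{N,r}$ satisfies $C_{\min}(d) = \max_{d' \in \mathcal{D}_{N,r}} C_{\min}(d')$ if and only if $d = \tau^j(d^{\mathrm{chr}}_{N,r})$ for some $0 \le j \le N-1$.
   Context: $\mathcal{D}_{N} = \{0,1\}^N$ is the set of binary words of length $N$, and $\mathcal{D}_{N,r}$ is the set of words $d=(d_1,\dots,d_N) \in \{0,1\}^N$ with exactly $r$ ones, i.e. $\sum_{j=1}^N d_j = r$. For $d \in \mathcal{D}_N$ and $0 \le i \le N$ put $r_i(d) = \sum_{j=i+1}^N d_j$ (so $r_N(d)=0$ and $r_0(d)$ is the number of ones). Define $$C(d) = \sum_{i=1}^{N} 2^{i-1}\, 3^{r_i(d)}\, d_i .$$ The rotation operator is $\tau(d_1,d_2,\dots,d_N) = (d_2,\dots,d_N,d_1)$, with iterates $\tau^j$, $\tau^0=\mathrm{id}$, and $$C_{\min}(d) = \min_{0 \le j \le N-1} C(\tau^j(d)).$$ The Christoffel word $d^{\mathrm{chr}}_{N,r} = (d_1,\dots,d_N) \in \mathcal{D}_{N,r}$ is defined by $d_i = \left\lceil \frac{i r}{N} \right\rceil - \left\lceil \frac{(i-1) r}{N} \right\rceil$ for $i=1,\dots,N$. *)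

(* Defs.v *)
From mathcomp Require Import all_boot all_order all_algebra.
From mathcomp Require Import lra.

Set Implicit Arguments.
Unset Strict Implicit.
Unset Printing Implicit Defensive.

Import Order.TTheory GRing.Theory Num.Theory.

(* The letter d_i of the text, with 1 <= i <= N, is [tnth d k] with k = i - 1;
   letters are booleans, read as 0 or 1 through the coercion to nat. *)
Definition word (N : nat) := N.-tuple bool.

Definition words_with_ones (N r : nat) : {set word N} :=
  [set d : word N | \sum_(k < N) tnth d k == r].

(* r_i(d) = d_{i+1} + ... + d_N: the condition j >= i + 1 is i <= k. *)
Definition ones_after (N : nat) (d : word N) (i : nat) : nat :=
  \sum_(k < N | i <= k) tnth d k.

Definition C (N : nat) (d : word N) : nat :=
  \sum_(k < N) 2 ^ k * 3 ^ ones_after d k.+1 * tnth d k.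

Definition tau (N : nat) (d : word N) : word N := [tuple of rot 1 d].

(* For N >= 1 the base value C d is the term j = 0, so it does not affect the
   minimum. *)
Definition Cmin (N : nat) (d : word N) : nat :=
  \big[minn/C d]_(j < N) C (iter j (@tau N) d).

Definition ceil_frac (N r i : nat) : int :=
  Num.ceil ((i * r)%:R / N%:R : rat)%R.

(* For r <= N the difference of ceilings is 0 or 1, see [christoffelE]. *)
Definition christoffel (N r : nat) : word N :=
  [tuple (ceil_frac N r k.+1 - ceil_frac N r k == 1)%R | k < N].

Lemma christoffelE (N r : nat) (k : 'I_N) : r <= N ->
  (tnth (christoffel N r) k)%:Z%R = (ceil_frac N r k.+1 - ceil_frac N r k)%R.
Proof.
move=> le_rN; rewrite tnth_mktuple.
have N_gt0 : (0 < N%:R :> rat)%R by rewrite ltr0n (leq_trans _ (ltn_ord k)).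
rewrite /ceil_frac mulSn natrD mulrDl.
set x := (_ / _ : rat)%R; set y := ((k * r)%:R / _ : rat)%R.
have x_ge0 : (0 <= x)%R by rewrite divr_ge0 ?ler0n.
have x_le1 : (x <= 1)%R by rewrite ler_pdivrMr // mul1r ler_nat.
have lo : (Num.ceil y <= Num.ceil (x + y))%R by apply: le_ceil; lra.
have hi : (Num.ceil (x + y) <= Num.ceil y + 1)%R.
  by rewrite ceil_le_int rmorphD /=; have := ceil_ge y; lra.
move: (Num.ceil y) (Num.ceil (x + y)%R) lo hi => a b lo hi.
have [-> // | ne1] := eqVneq (b - a)%R 1%R.
have : (b - a < 1)%R by rewrite lt_neqAle ne1 lerBlDl.
by rewrite -[1%R]add0r ltzD1 => le0; apply/esym/le_anti; rewrite le0 subr_ge0.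
Qed.

Lemma christoffel_ones (N r : nat) : 0 < N -> r <= N ->
  christoffel N r \in words_with_ones N r.
Proof.
move=> N_gt0 le_rN; rewrite inE -eqz_nat -[Posz (\sum_(_ < _) _)]natz natr_sum.
under eq_bigr => k _ do rewrite natz christoffelE //.
rewrite -(big_mkord xpredT (fun k => ceil_frac N r k.+1 - ceil_frac N r k)%R).
rewrite telescope_sumr // /ceil_frac mul0n mul0r ceil0 subr0.
by rewrite natrM mulrAC mulfV ?pnatr_eq0 -?lt0n // mul1r pmulrn intrKceil.
Qed.

(* Main.v *)
(** Write S_i for the number of ones among the first i letters.  Summation by
    parts gives 4 C(d) + 2^N = 3^r + sum_(k < N) 2^k 3^(r - S_k), so C is
    strictly decreasing in each S_k.  The Christoffel word has
    S_i = ceil(i r / N).  As ceil is subadditive, its rotations have no larger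
    prefix sums, so it minimizes C among its rotations.  Conversely, by the cycle
    lemma, rotating any word to a point where N S_m - m r is minimal yields
    S_i >= ceil(i r / N) for all i, so this rotation has C at most that of the
    Christoffel word, with equality only if the two words coincide. *)
Require Import Defs.
From mathcomp Require Import all_boot.
From mathcomp Require Import all_order all_algebra zify.

Set Implicit Arguments.
Unset Strict Implicit.
Unset Printing Implicit Defensive.

Import Order.TTheory GRing.Theory Num.Theory.

(** Indices are read modulo [N], so a rotation becomes a shift of the index and prefix sums may run
    past the end of the word. *)
Definition letter (N : nat) (d : word N) (k : nat) : bool := nth false d (k %% N).

Definition prefix_ones (N : nat) (d : word N) (i : nat) : nat :=
  \sum_(k < i) letter d k.

Lemma letter_ord (N : nat) (d : word N) (k : 'I_N) : letter d k = tnth d k.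
Proof. by rewrite /letter modn_small // (tnth_nth false). Qed.

Lemma letter_inj (N : nat) (d e : word N) : letter d =1 letter e -> d = e.
Proof. by move=> de; apply: eq_from_tnth => k; rewrite -!letter_ord. Qed.

Lemma letter_tau (N : nat) (d : word N) (k : nat) :
  letter (tau d) k = letter d k.+1.
Proof.
case: N d => [|N] d; first by rewrite (tuple0 d) (tuple0 (tau _)) /letter !nth_nil.
rewrite /letter /= -[k.+1]addn1 -modnDml.
have: k %% N.+1 < N.+1 by rewrite ltn_pmod.
move: (k %% N.+1) => {}k kN; rewrite nth_cat size_drop size_tuple subn1 /=.
rewrite nth_drop add1n addn1; case: ltnP => [lt_kN|le_Nk].
  by rewrite modn_small.
have -> : k = N by lia.
by rewrite subnn modnn nth_take.
Qed.

Lemma letter_iter_tau (N : nat) (d : word N) (j k : nat) :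
  letter (iter j (@tau N) d) k = letter d (j + k).
Proof. by elim: j k => //= j IHj k; rewrite letter_tau IHj addSnnS. Qed.

Lemma iter_tau_mod (N : nat) (d : word N) (j : nat) :
  iter (j %% N) (@tau N) d = iter j (@tau N) d.
Proof.
by apply: letter_inj => k; rewrite !letter_iter_tau /letter modnDml.
Qed.

Lemma iter_tauN (N : nat) (d : word N) : iter N (@tau N) d = d.
Proof. by rewrite -iter_tau_mod modnn. Qed.

Lemma prefix_onesS (N : nat) (d : word N) (i : nat) :
  prefix_ones d i.+1 = prefix_ones d i + letter d i.
Proof. by rewrite /prefix_ones big_ord_recr. Qed.

Lemma prefix_ones_iter_tau (N : nat) (d : word N) (j i : nat) :
  prefix_ones d (j + i) = prefix_ones d j + prefix_ones (iter j (@tau N) d) i.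
Proof.
elim: i => [|i IHi]; first by rewrite addn0 /prefix_ones big_ord0 addn0.
by rewrite addnS !prefix_onesS IHi letter_iter_tau addnA.
Qed.

Lemma leq_prefix_ones (N : nat) (d : word N) (i j : nat) :
  i <= j -> prefix_ones d i <= prefix_ones d j.
Proof. by move=> /subnKC <-; rewrite prefix_ones_iter_tau leq_addr. Qed.

Lemma prefix_ones_inj (N : nat) (d e : word N) :
  (forall i, i <= N -> prefix_ones d i = prefix_ones e i) -> d = e.
Proof.
move=> de; apply: eq_from_tnth => k; rewrite -!letter_ord.
have := de k.+1 (ltn_ord k); rewrite !prefix_onesS de 1?ltnW //.
by move/addnI; do 2!case: (letter _ _).
Qed.

Section FixedNumberOfOnes.

Variables (N r : nat).

Lemma words_with_onesE (d : word N) :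
  (d \in words_with_ones N r) = (prefix_ones d N == r).
Proof. by rewrite inE; under eq_bigr do rewrite -letter_ord. Qed.

(** Each full period contributes [r] ones. *)
Lemma prefix_ones_divn (d : word N) (i : nat) : d \in words_with_ones N r ->
  prefix_ones d i = i %/ N * r + prefix_ones d (i %% N).
Proof.
rewrite words_with_onesE => /eqP dr; rewrite {1}(divn_eq i N).
elim: (i %/ N) => [|q IHq] //.
by rewrite !mulSn -!addnA prefix_ones_iter_tau dr iter_tauN IHq.
Qed.

Lemma iter_tau_words (d : word N) (j : nat) :
  d \in words_with_ones N r -> iter j (@tau N) d \in words_with_ones N r.
Proof.
rewrite !words_with_onesE => dr.
(* The ones among the first [N + j] letters are counted twice, cutting after [N] and after [j]. *)
have := prefix_ones_iter_tau d N j; have := prefix_ones_iter_tau d j N.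
by rewrite iter_tauN addnC (eqP dr) => -> /eqP; rewrite addnC eqn_add2r.
Qed.

Lemma ones_after_prefix (d : word N) (i : nat) :
  i <= N -> d \in words_with_ones N r -> ones_after d i = r - prefix_ones d i.
Proof.
move=> le_iN; rewrite words_with_onesE => /eqP <-.
have -> : ones_after d i = \sum_(i <= k < N) letter d k.
  rewrite /ones_after big_geq_mkord; apply: eq_bigr => k _.
  by rewrite letter_ord.
rewrite /prefix_ones -!(big_mkord xpredT (fun k => letter d k : nat)).
by rewrite [in RHS](big_cat_nat _ le_iN) //= addKn.
Qed.

Lemma C_prefix_ones (d : word N) : d \in words_with_ones N r ->
  4 * C d + 2 ^ N = 3 ^ r + \sum_(k < N) 2 ^ k * 3 ^ (r - prefix_ones d k).
Proof.
move=> dr; have /eqP dN : prefix_ones d N == r by rewrite -words_with_onesE.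
pose a k := 3 ^ (r - prefix_ones d k).
(* The last factor is 3 to the power [letter d k]; the bound [prefix_ones d k.+1 <= r] keeps the
   truncated subtraction exact. *)
have aS k : k < N -> a k = a k.+1 * (2 * letter d k).+1.
  move=> ltkN; rewrite /a prefix_onesS.
  have := leq_prefix_ones d ltkN; rewrite prefix_onesS dN.
  case: (letter d k) => /= h; last by rewrite addn0 muln1.
  by rewrite -expnSr; congr (_ ^ _); lia.
have -> : C d = \sum_(k < N) 2 ^ k * a k.+1 * letter d k.
  by apply: eq_bigr => k _; rewrite (@ones_after_prefix _ k.+1) // letter_ord.
(* By [aS], each step turns [2 ^ n.+1 * a n.+1 * (2 * letter d n).+1] into [2 ^ n.+1 * a n], half of
   which is the new summand; the boundary term is [2 ^ N] at [n = N]. *)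
suff {dN} H n : n <= N -> 4 * (\sum_(k < n) 2 ^ k * a k.+1 * letter d k)
    + 2 ^ n * a n = 3 ^ r + \sum_(k < n) 2 ^ k * a k.
  by have := H N (leqnn N); rewrite {2}/a dN subnn muln1.
elim: n => [|n IHn] lt_nN.
  by rewrite !big_ord0 /a /prefix_ones big_ord0 subn0 mul1n addn0.
have := IHn (ltnW lt_nN); rewrite !big_ord_recr /= expnS (aS n lt_nN).
by case: (letter d n) => /=; lia.
Qed.

(** The equality case serves uniqueness: the sums are compared term by term, and prefix sums
    determine the word. *)
Lemma leqif_C (d e : word N) :
    d \in words_with_ones N r -> e \in words_with_ones N r ->
    (forall i, i < N -> prefix_ones e i <= prefix_ones d i) ->
  C d <= C e ?= iff (d == e).
Proof.
move=> dr er le_ed.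
have dN : prefix_ones d N = r by apply/eqP; rewrite -words_with_onesE.
have eN : prefix_ones e N = r by apply/eqP; rewrite -words_with_onesE.
pose F (w : word N) k := 2 ^ k * 3 ^ (r - prefix_ones w k).
have leF (k : 'I_N) : true ->
    F d k <= F e k ?= iff (prefix_ones d k == prefix_ones e k).
  move=> _; split.
    by rewrite leq_pmul2l ?expn_gt0 // leq_pexp2l // leq_sub2l ?le_ed.
  (* Both prefix sums are at most [r], so equal truncated exponents force equal prefix sums. *)
  rewrite eqn_pmul2l ?expn_gt0 // eqn_exp2l //.
  have := leq_prefix_ones d (ltnW (ltn_ord k)).
  have := leq_prefix_ones e (ltnW (ltn_ord k)).
  by rewrite dN eN; lia.
pose S w := \sum_(k < N) F w k.
have CS (w : word N) : w \in words_with_ones N r -> 4 * C w + 2 ^ N = 3 ^ r + S w.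
  exact: C_prefix_ones.
have [leS eqS] : S d <= S e ?= iff
    [forall k : 'I_N, prefix_ones d k == prefix_ones e k] := leqif_sum leF.
have := CS d dr; have := CS e er => Ce Cd; split; first by lia.
apply/eqP/eqP => [CdCe|-> //]; apply: prefix_ones_inj => i.
rewrite leq_eqVlt => /orP[/eqP->|lt_iN]; first by rewrite dN eN.
have /forallP : [forall k : 'I_N, prefix_ones d k == prefix_ones e k].
  by rewrite -eqS; apply/eqP; lia.
by move=> /(_ (Ordinal lt_iN)) /eqP.
Qed.

Hypotheses (N_gt0 : 0 < N) (le_rN : r <= N).

Notation chr := (christoffel N r).

Let chr_word : chr \in words_with_ones N r.
Proof. exact: christoffel_ones. Qed.

(** A division-free form of the ceiling of [i * r / N], valid past the end of the word too. *)
Lemma prefix_ones_christoffel (i : nat) :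
  i * r <= N * prefix_ones chr i < i * r + N.
Proof.
(* Advancing [i] by [N] adds [N * r] to all three sides. *)
wlog lt_iN : i / i < N.
  move=> IH; have := IH _ (ltn_pmod i N_gt0).
  rewrite (prefix_ones_divn i) // mulnDr.
  move: (i %/ N) (i %% N) (divn_eq i N) => q m ->.
  by rewrite (mulnC q) !mulnDl mulnA -addnA !leq_add2l ltn_add2l.
have SE : ((prefix_ones chr i)%:Z = ceil_frac N r i)%R.
  elim: i lt_iN => [|i IHi] lt_iN.
    by rewrite /prefix_ones big_ord0 /ceil_frac mul0n mul0r ceil0.
  rewrite prefix_onesS PoszD IHi 1?ltnW //.
  by rewrite (letter_ord _ (Ordinal (ltnW lt_iN))) christoffelE //= addrC subrK.
have N_gt0Q : (0 < N%:R :> rat)%R by rewrite ltr0n.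
have := ceil_itv ((i * r)%:R / N%:R : rat)%R.
rewrite -/(ceil_frac N r i) -SE ler_pdivrMr // ltr_pdivlMr //.
rewrite rmorphB /= -pmulrn mulrBl mul1r ltrBlDr -!natrM -natrD ltr_nat ler_nat.
by rewrite mulnC => /andP[-> ->].
Qed.

Lemma C_christoffel_le_rotation (j : nat) : C chr <= C (iter j (@tau N) chr).
Proof.
apply: leqif_C => [//||i _]; first exact: iter_tau_words.
(* For the prefix sum s of the rotation, [N * s < i * r + N <= N * prefix_ones chr i + N]. *)
have := prefix_ones_iter_tau chr j i.
have := prefix_ones_christoffel i; have := prefix_ones_christoffel j.
have := prefix_ones_christoffel (j + i).
by nia.
Qed.

Lemma rotation_C_leqif_christoffel (d : word N) : d \in words_with_ones N r ->
  exists2 j, j < N &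
    C (iter j (@tau N) d) <= C chr ?= iff (iter j (@tau N) d == chr).
Proof.
(* The summand [N * r] hidden in [f] keeps [N * prefix_ones d k - k * r] nonnegative. *)
move=> dr; pose f (k : 'I_N) := N * prefix_ones d k + (N - k) * r.
case: (arg_minnP f (i0 := Ordinal N_gt0) (P := xpredT)) => // m _ min_m.
(* The minimum over one period is a minimum over all [k], since [N * prefix_ones d k - k * r] has
   period [N]. *)
have minS k : N * prefix_ones d m + k * r <= N * prefix_ones d k + m * r.
  rewrite (prefix_ones_divn k) // {1}(divn_eq k N).
  have := min_m (Ordinal (ltn_pmod k N_gt0)) isT; rewrite /f /=.
  have := ltn_pmod k N_gt0; have := ltn_ord m.
  move: (k %/ N) (k %% N) (m : nat) => q k' m' lt_m lt_k'.
  by rewrite !mulnBl; have := leq_mul2r r k' N; have := leq_mul2r r m' N; lia.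
exists m => //; apply: leqif_C => //; first exact: iter_tau_words.
(* Minimality at [m] gives [i * r <= N * s] for the prefix sum s of the rotation, so s is at least
   the ceiling. *)
move=> i _; have := minS (m + i); have := prefix_ones_iter_tau d m i.
by have := prefix_ones_christoffel i; nia.
Qed.

End FixedNumberOfOnes.

Lemma Cmin_le (N : nat) (d : word N) (j : nat) :
  j < N -> Cmin d <= C (iter j (@tau N) d).
Proof.
move=> lt_jN; rewrite /Cmin.
elim: (index_enum _) (mem_index_enum (Ordinal lt_jN)) => // k s IHs.
rewrite inE big_cons geq_min => /orP[/eqP<- /=|/IHs->]; last by rewrite orbT.
by rewrite leqnn.
Qed.

Lemma le_Cmin (N : nat) (d : word N) (c : nat) :
  (forall j, c <= C (iter j (@tau N) d)) -> c <= Cmin d.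
Proof.
move=> le_c; rewrite /Cmin; elim/big_ind: _ => [|x y cx cy|j _ //].
  (* The default value of the iterated minimum is the term [j = 0]. *)
  exact: (le_c 0).
by rewrite leq_min cx.
Qed.

Theorem theorem7p3 (N r : nat) (hN : 0 < N) (hr : r <= N) :
  \max_(d in words_with_ones N r) Cmin d = C (christoffel N r) /\
  (forall d : word N, d \in words_with_ones N r ->
    (Cmin d = \max_(d' in words_with_ones N r) Cmin d' <->
     exists2 j : nat, j < N & d = iter j (@tau N) (christoffel N r))).
Proof.
have chr_word := christoffel_ones hN hr.
have le_chr d : d \in words_with_ones N r -> Cmin d <= C (christoffel N r).
  move=> /(rotation_C_leqif_christoffel hN hr)[j lt_jN [le_j _]].
  exact: leq_trans (Cmin_le d lt_jN) le_j.
have Cmin_rot j : Cmin (iter j (@tau N) (christoffel N r)) = C (christoffel N r).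
  apply/eqP; rewrite eqn_leq le_chr ?iter_tau_words //=.
  by apply: le_Cmin => i; rewrite -iterD C_christoffel_le_rotation.
have maxE : \max_(d in words_with_ones N r) Cmin d = C (christoffel N r).
  apply/eqP; rewrite eqn_leq; apply/andP; split; first exact/bigmax_leqP.
  by rewrite -{1}(Cmin_rot 0) /= (leq_bigmax_cond _ chr_word).
split=> // d dr; rewrite maxE; split=> [Cd|[j _ ->]]; last exact: Cmin_rot.
have [j lt_jN [le_j eq_j]] := rotation_C_leqif_christoffel hN hr dr.
(* The chain [Cmin d <= C (iter j (@tau N) d) <= C (christoffel N r)] has equal ends, so the
   equality case applies. *)
have rot_d : iter j (@tau N) d = christoffel N r.
  by apply/eqP; rewrite -eq_j eqn_leq le_j -Cd Cmin_le.
(* This undoes the rotation by [j]; the reduction matters for [j = 0], where [N - j] is [N]. *)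
exists ((N - j) %% N); first by rewrite ltn_pmod.
by rewrite iter_tau_mod -rot_d -iterD subnK 1?ltnW // iter_tauN.
Qed.
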